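(* Suppose that the constraint qualification (CQ) stated in the context holds. Let $\hat{\mathcal{X}}=\{\boldsymbol{x}\in\mathcal{X}:\phi(\boldsymbol{x})\le0\}$ and let $\bar{\boldsymbol{x}}\in\mathcal{X}$ be given. Then the following statements are equivalent: (a) $\bar{\boldsymbol{x}}$ is a local minimizer of $\min\{f(\boldsymbol{x}):\boldsymbol{x}\in\hat{\mathcal{X}}\}$, i.e., $\bar{\boldsymbol{x}}\in\hat{\mathcal{X}}$ and there exists $r_0>0$ such that $f(\bar{\boldsymbol{x}})\le f(\boldsymbol{x})$ for all $\boldsymbol{x}\in\hat{\mathcal{X}}\cap B(\bar{\boldsymbol{x}},r_0)$; (b) $\phi(\bar{\boldsymbol{x}})\le0$ and there exists $\bar\sigma>0$ such that, for every $\sigma>\bar\sigma$, $\bar{\boldsymbol{x}}$ is a local minimizer of $\min_{\boldsymbol{x}\in\mathcal{X}}\{f(\boldsymbol{x})+\sigma[\phi(\boldsymbol{x})]_+\}$, i.e., there exists $r_\sigma>0$ such that $$f(\bar{\boldsymbol{x}})+\sigma[\phi(\bar{\boldsymbol{x}})]_+\le f(\boldsymbol{x})+\sigma[\phi(\boldsymbol{x})]_+\qquad\forall\,\boldsymbol{x}\in\mathcal{X}\cap B(\bar{\boldsymbol{x}},r_\sigma).$$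
   Context: $[n]=\{1,\dots,n\}$, $[t]_+=\max\{t,0\}$, $B(\bar{\boldsymbol{x}},r)$ is the open Euclidean ball. Let $S,I$ be positive integers, $\alpha\in(0,1)$, $m=\lfloor\alpha S\rfloor$. Standing assumptions: $\mathcal{X}\subseteq\mathbb{R}^d$ is compact, convex, with nonempty relative interior, contained in an open set $\mathcal{U}\subseteq\mathbb{R}^d$; $f:\mathcal{U}\to\mathbb{R}$ is continuously differentiable and convex; for each $s\in[S]$ (scenario), $g_s(\boldsymbol{x})=\max_{i\in[I]}h_{s,i}(\boldsymbol{x})$ where each $h_{s,i}:\mathbb{R}^d\to\mathbb{R}$ is continuously differentiable and convex. Let $g_{(1)}(\boldsymbol{x})\le\cdots\le g_{(S)}(\boldsymbol{x})$ be the nondecreasing rearrangement of $(g_1(\boldsymbol{x}),\dots,g_S(\boldsymbol{x}))$, and define $$G_1(\boldsymbol{x})=\sum_{s=S-m}^{S}g_{(s)}(\boldsymbol{x}),\qquad G_2(\boldsymbol{x})=\sum_{s=S-m+1}^{S}g_{(s)}(\boldsymbol{x}),\qquad \phi(\boldsymbol{x})=G_1(\boldsymbol{x})-G_2(\boldsymbol{x}).$$ For a locally Lipschitz function $\phi$, the Clarke directional derivative is $\phi^\circ(\bar{\boldsymbol{x}};\boldsymbol{d})=\limsup_{\boldsymbol{x}\to\bar{\boldsymbol{x}},\,t\downarrow0}\frac{\phi(\boldsymbol{x}+t\boldsymbol{d})-\phi(\boldsymbol{x})}{t}$, which equals $\sup_{\boldsymbol{v}\in\partial\phi(\bar{\boldsymbol{x}})}\langle\boldsymbol{v},\boldsymbol{d}\rangle$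 with $\partial\phi$ the Clarke subdifferential; $\mathcal{T}_{\mathcal{X}}(\bar{\boldsymbol{x}})$ is the tangent cone of the convex set $\mathcal{X}$ at $\bar{\boldsymbol{x}}$. (CQ): for every $\bar{\boldsymbol{x}}\in\mathcal{X}$ with $\phi(\bar{\boldsymbol{x}})=0$ there exists $\boldsymbol{d}\in\mathcal{T}_{\mathcal{X}}(\bar{\boldsymbol{x}})$ such that $\phi^\circ(\bar{\boldsymbol{x}};\boldsymbol{d})<0$. *)

(* Defs.v *)
From HB Require Import structures.
From mathcomp Require Import all_boot all_order all_algebra.
From mathcomp Require Import all_classical all_reals all_analysis.

Set Implicit Arguments.
Unset Strict Implicit.
Unset Printing Implicit Defensive.

Import Order.TTheory GRing.Theory Num.Theory.
Import numFieldNormedType.Exports.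

Local Open Scope classical_set_scope.
Local Open Scope ring_scope.

(* The norm carried by 'rV[R]_d in the library is the sup norm. It induces the
   Euclidean topology, but its balls are cubes, hence the definitions below. *)
Definition enorm (R : realType) (d : nat) (x : 'rV[R]_d) : R :=
  Num.sqrt (\sum_(i < d) x ord0 i ^+ 2).

Definition eball (R : realType) (d : nat) (x : 'rV[R]_d) (r : R) :
    set 'rV[R]_d :=
  [set y | enorm (y - x) < r].

Definition affine_set (R : realType) (d : nat) (A : set 'rV[R]_d) : Prop :=
  forall (x y : 'rV[R]_d) (t : R), A x -> A y -> A ((1 - t) *: x + t *: y).

Definition affine_hull (R : realType) (d : nat) (A : set 'rV[R]_d) :
    set 'rV[R]_d :=
  [set x | forall B : set 'rV[R]_d, affine_set B -> A `<=` B -> B x].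

Definition relative_interior (R : realType) (d : nat) (A : set 'rV[R]_d) :
    set 'rV[R]_d :=
  [set x | A x /\ exists2 r : R, 0 < r & eball x r `&` affine_hull A `<=` A].

Definition tangent_cone (R : realType) (d : nat) (A : set 'rV[R]_d)
    (x : 'rV[R]_d) : set 'rV[R]_d :=
  [set v | exists (u : nat -> 'rV[R]_d) (t : nat -> R),
     [/\ forall n, A (u n),
         forall n, 0 < t n,
         u @ \oo --> x,
         t @ \oo --> 0 &
         (fun n => (t n)^-1 *: (u n - x)) @ \oo --> v]].

Definition gradient (R : realType) (d : nat) (f : 'rV[R]_d -> R)
    (x : 'rV[R]_d) : 'rV[R]_d :=
  \row_(i < d) 'D_(delta_mx ord0 i) f x.

(* For open U: only the values of f on U matter. *)
Definition continuously_differentiable (R : realType) (d : nat)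
    (U : set 'rV[R]_d) (f : 'rV[R]_d -> R) : Prop :=
  forall x, U x -> differentiable f x /\ {for x, continuous (gradient f)}.

(* U need not be convex, so the convexity inequality is only required along
   segments contained in U, where f is meaningful. For convex U this is
   convex_function U f. *)
Definition convex_on (R : realType) (d : nat) (U : set 'rV[R]_d)
    (f : 'rV[R]_d -> R) : Prop :=
  forall C : set 'rV[R]_d, C `<=` U ->
    @convex_set R 'rV[R]_d C -> @convex_function R 'rV[R]_d C f.

Definition max_fun (R : realType) (d n : nat) (n_gt0 : (0 < n)%N)
    (h : 'I_n -> 'rV[R]_d -> R) (x : 'rV[R]_d) : R :=
  \big[Num.max/h (Ordinal n_gt0) x]_(i < n) h i x.

(* g_(k), with k ranging over 1, ..., n *)
Definition order_stat (R : realType) (d n : nat) (g : 'I_n -> 'rV[R]_d -> R)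
    (k : nat) (x : 'rV[R]_d) : R :=
  nth 0 (sort <=%R [seq g s x | s <- enum 'I_n]) k.-1.

Definition G1 (R : realType) (d n m : nat) (g : 'I_n -> 'rV[R]_d -> R)
    (x : 'rV[R]_d) : R :=
  \sum_(n - m <= s < n.+1) order_stat g s x.

Definition G2 (R : realType) (d n m : nat) (g : 'I_n -> 'rV[R]_d -> R)
    (x : 'rV[R]_d) : R :=
  \sum_((n - m).+1 <= s < n.+1) order_stat g s x.

(* truncn is the floor, as a natural number, on nonnegative reals. *)
Definition phi (R : realType) (d n : nat) (alpha : R)
    (g : 'I_n -> 'rV[R]_d -> R) (x : 'rV[R]_d) : R :=
  let m := Num.truncn (alpha * n%:R) in G1 m g x - G2 m g x.

Definition clarke_derivative (R : realType) (d : nat) (p : 'rV[R]_d -> R)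
    (x v : 'rV[R]_d) : \bar R :=
  limf_esup
    (fun z : 'rV[R]_d * R => ((p (z.1 + z.2 *: v) - p z.1) / z.2)%:E)
    (filter_prod (nbhs x) 0^'+).

Definition clarke_cq (R : realType) (d : nat) (X : set 'rV[R]_d)
    (p : 'rV[R]_d -> R) : Prop :=
  forall x, X x -> p x = 0 ->
    exists2 v, tangent_cone X x v & (clarke_derivative p x v < 0)%E.

Definition pos_part (R : realType) (t : R) : R := Num.max t 0.

Definition local_minimizer (R : realType) (d : nat) (A : set 'rV[R]_d)
    (F : 'rV[R]_d -> R) (x : 'rV[R]_d) : Prop :=
  A x /\ exists2 r : R, 0 < r & forall y, A y -> eball x r y -> F x <= F y.

(* Main.v *)
Require Import Defs.
From HB Require Import structures.
From mathcomp Require Import all_boot all_order all_algebra.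
From mathcomp Require Import all_classical all_reals all_analysis.

From mathcomp Require Import ring lra.
Set Implicit Arguments.
Unset Strict Implicit.
Unset Printing Implicit Defensive.

Import Order.TTheory GRing.Theory Num.Theory.
Import numFieldNormedType.Exports.

Local Open Scope classical_set_scope.
Local Open Scope ring_scope.

(** That (b) implies (a) is immediate, the penalty being zero on the feasible
    set.  The converse is exact penalization through a linear error bound: every
    [y] of [X] near [xbar] is within [C * pos_part (phi y)] of a feasible point
    [z].  If [k] is a Lipschitz constant of [f] near [xbar], then
    [f xbar <= f z <= f y + k * C * pos_part (phi y)], so any
    [sigma >= k * C] works ([exact_penalty]).

    When [phi xbar < 0] the error bound is trivial by continuity.  When
    [phi xbar = 0] it comes from the constraint qualification
    ([linear_error_bound]).  A negative Clarke derivative along [v] is a uniform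
    statement: [phi] decreases at a linear rate [c] along [v] from every point
    near [xbar] ([clarke_descent]).  As [phi] is Lipschitz, rate [c / 2]
    persists along all directions close to [v].  A tangent vector is a limit of
    [(t n)^-1 *: (u n - xbar)] with [u n] in [X].  Fixing one large [n], the
    direction [(t n)^-1 *: (u n - y)] is close to [v] for all [y] near [xbar],
    and by convexity it leads from [y] into [X].  Adding
    [2 * phi y / c] times this direction to [y] therefore gives a feasible
    point.

    The regularity needed is that [f] and [phi] be Lipschitz near [xbar].  A C1
    function is so by the mean value theorem.  The function [phi] telescopes to
    a single order statistic of the [g s] ([phiE]), and maxima and order
    statistics are nonexpansive for the sup norm on the tuple of values. *)

(** * Euclidean and sup norms *)

Lemma ler_norm_enorm (R : realType) (d : nat) (x : 'rV[R]_d) : `|x| <= enorm x.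
Proof.
rewrite /Num.Def.normr/= mx_normrE; apply/bigmax_leP; split.
  exact: sqrtr_ge0.
move=> [i j] _ /=; rewrite (ord1 i) -sqrtr_sqr ler_wsqrtr//.
rewrite (bigD1 j)//= lerDl; apply: sumr_ge0 => k _; exact: sqr_ge0.
Qed.

Lemma ler_coord_norm (R : realType) (d : nat) (x : 'rV[R]_d) i :
  `|x ord0 i| <= `|x|.
Proof.
rewrite [leRHS]/Num.Def.normr/= mx_normrE.
by apply/bigmax_geP; right; exists (ord0, i).
Qed.

Lemma ler_enorm_norm (R : realType) (d : nat) (x : 'rV[R]_d) :
  enorm x <= d%:R * `|x|.
Proof.
have dx0 : 0 <= d%:R * `|x| by rewrite mulr_ge0.
rewrite -[leRHS]ger0_norm// -sqrtr_sqr ler_wsqrtr//.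
apply: (@le_trans _ _ (\sum_(i < d) `|x| ^+ 2)).
  apply: ler_sum => i _; rewrite -(real_normK (num_real _)).
  by rewrite lerXn2r ?nnegrE// ler_coord_norm.
rewrite sumr_const card_ord exprMn -[leLHS]mulr_natl ler_wpM2r ?sqr_ge0//.
by rewrite -natrX ler_nat; case: (d) => // n; rewrite expnS expn1 leq_pmulr.
Qed.

(** Lets the whole proof be carried out with the sup norm, the
    Euclidean balls appearing only where local minimizers are unfolded. *)
Lemma nbhs_eballP (R : realType) (d : nat) (x : 'rV[R]_d)
    (P : set 'rV[R]_d) :
  (\forall y \near x, P y) <-> exists2 r : R, 0 < r & eball x r `<=` P.
Proof.
split=> [/nbhs_ballP[r /= r0 rP]|[r r0 rP]].
  exists r => // y xyr; apply: rP; rewrite -ball_normE/= distrC.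
  exact: le_lt_trans (ler_norm_enorm _) xyr.
(* d.+1 rather than d, which may be 0 *)
apply/nbhs_ballP; exists (r / d.+1%:R) => /=; first by rewrite divr_gt0.
move=> y; rewrite -ball_normE/= distrC => xyr; apply: rP => /=.
apply: le_lt_trans (ler_enorm_norm _) _.
apply: (@le_lt_trans _ _ (d.+1%:R * `|y - x|)).
  by rewrite ler_wpM2r// ler_nat.
by rewrite mulrC -ltr_pdivlMr.
Qed.

(** * Functions that are Lipschitz near a point *)

Lemma lipschitz_nearP (R : realType) (V : normedModType R) (f : V -> R)
    (x : V) :
  lipschitz_on f (nbhs (x, x)) ->
  exists k e, [/\ 0 < k, 0 < e & forall y z, `|x - y| < e -> `|x - z| < e ->
    `|f y - f z| <= k * `|y - z|].
Proof.
move=> fL; near (+oo : set_system R) => k.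
have fk : k.-lipschitz_on f (nbhs (x, x)) by near: k.
have /nbhs_ballP[e /= e0 efk] := fk.
exists k, e; split => // y z xy xz.
by apply: (efk (y, z)); split; rewrite -ball_normE.
Unshelve. all: by end_near. Qed.

Lemma lipschitz_near_continuous (R : realType) (V : normedModType R)
    (f : V -> R) (x : V) :
  lipschitz_on f (nbhs (x, x)) -> {for x, continuous f}.
Proof.
move=> /lipschitz_nearP[k [e [k0 e0 fk]]]; apply/cvgrPdist_lt => eps eps0.
have r0 : 0 < Num.min e (eps / k) by rewrite lt_min e0 divr_gt0.
apply/nbhs_ballP; exists (Num.min e (eps / k)) => // y; rewrite -ball_normE /=.
rewrite lt_min ltr_pdivlMr// mulrC => /andP[xye].
by apply: le_lt_trans; apply: fk => //; rewrite subrr normr0.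
Qed.

(** The derivative along [y - z] is a combination of partial derivatives, so a
    local bound [K] on the gradient and the mean value theorem on the segment
    from [z] to [y] give the constant [d * K]. *)
Lemma C1_lipschitz_near (R : realType) (d : nat) (U : set 'rV[R]_d)
    (f : 'rV[R]_d -> R) (x : 'rV[R]_d) :
  open U -> continuously_differentiable U f -> U x ->
  lipschitz_on f (nbhs (x, x)).
Proof.
move=> Uop fC1 Ux; have [_ gradx] := fC1 x Ux.
pose K := `|gradient f x| + 1.
apply: (@klipschitzW _ _ _ (d%:R * K)).
have : \forall z \near x, `|gradient f z| <= K.
  near=> u; apply: ltW; near: u.
  by apply: (cvgr_lt _ (cvg_norm gradx)); rewrite /K ltrDl.
have : \forall z \near x, U z by exact: open_nbhs_nbhs.
move=> /filterI/[apply] /nbhs_ballP[e /= e0 eP].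
apply/nbhs_ballP; exists e => //= -[y z] [/= xy xz].
pose w (t : R) := z + t *: (y - z).
have wball (t : R) : t \in `[0, 1] -> ball x e (w t).
  rewrite in_itv/= => /andP[t0 t1].
  move: xy xz; rewrite -ball_normE /= => xy xz.
  have -> : x - w t = t *: (x - y) + (1 - t) *: (x - z).
    by rewrite /w; apply/rowP => i; rewrite !mxE; ring.
  rewrite (le_lt_trans (ler_normD _ _))// !normrZ (ger0_norm t0).
  rewrite (@ger0_norm _ (1 - t)) ?subr_ge0//.
  have [xyz|/ltW xyz] := leP `|x - y| `|x - z|.
    by apply: le_lt_trans xz; nra.
  by apply: le_lt_trans xy; nra.
have fw (t : R) : t \in `[0, 1] ->
    is_derive t (1 : R) (f \o w) ('D_(y - z) f (w t)).
  move=> t01; have [/= Uw _] := eP _ (wball _ t01).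
  have fdrv := diff_derivable (v := y - z) (fC1 _ Uw).1.
  (* both derivatives are limits of the same difference quotient *)
  have quotE :
      (fun h => h^-1 *: ((f \o w \o shift t) (h *: 1) - (f \o w) t)) =
      (fun h => h^-1 *: ((f \o shift (w t)) (h *: (y - z)) - f (w t))).
    apply/funext => h /=; congr (_ *: (f _ - _)).
    by rewrite /w [h *: 1]mulr1 scalerDl addrCA.
  split; last by rewrite /derive quotE.
  by rewrite /derivable quotE.
have w_cont : {within `[0, 1], continuous (f \o w)}.
  by apply: derivable_within_continuous => t /fw[].
have fwo (t : R) : t \in `]0, 1[ ->
    is_derive t (1 : R) (f \o w) ('D_(y - z) f (w t)).
  by move/subset_itv_oo_cc; exact: fw.
have [c c01] := @MVT_segment R (f \o w) (fun t => 'D_(y - z) f (w t)) 0 1 ler01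
  fwo w_cont.
rewrite subr0 mulr1 /= {1 2}/w scale1r subrKC scale0r addr0 => ->.
have [/= Uw Kw] := eP _ (wball _ c01).
rewrite deriveE; last by have [] := fC1 _ Uw.
rewrite [X in 'd f _ X]row_sum_delta linear_sum /=.
apply: le_trans (ler_norm_sum _ _ _) _.
have -> : d%:R * K * `|y - z| = \sum_(i < d) K * `|y - z|.
  by rewrite sumr_const card_ord -mulrA mulr_natl.
apply: ler_sum => i _; rewrite linearZ/= normrM mulrC.
rewrite ler_pM// ?ler_coord_norm// -deriveE; last by have [] := fC1 _ Uw.
apply: le_trans Kw; have := ler_coord_norm (gradient f (w c)) i.
by rewrite mxE.
Unshelve. all: by end_near. Qed.

(** * Order statistics *)

(** At least [k + 1] entries of [map b s] are at most [B], its entry of rank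
    [k], and the corresponding entries of [map a s] are at most [B + e]. *)
Lemma ler_nth_sort (R : realType) (I : Type) (s : seq I) (a b : I -> R)
    (e : R) (k : nat) :
  (forall i, a i <= b i + e) -> (k < size s)%N ->
  nth 0 (sort <=%R (map a s)) k <= nth 0 (sort <=%R (map b s)) k + e.
Proof.
move=> ab ks; set B := nth 0 (sort _ (map b s)) k.
apply: nth_count_le; first exact: sort_le_sorted.
have : (k < count (<= B) (sort <=%R (map b s)))%N.
  rewrite ltnNge; apply/negP => cB.
  suff : B < B by rewrite ltxx.
  by apply: nth_count_gt; rewrite ?sort_le_sorted// cB size_sort size_map.
move=> /leq_trans; apply; rewrite !count_sort !count_map.
by apply: sub_count => i /= bB; rewrite (le_trans (ab _))// lerD2r.
Qed.

Lemma max_fun_le (R : realType) (d n : nat) (n0 : (0 < n)%N)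
    (h : 'I_n -> 'rV[R]_d -> R) (x y : 'rV[R]_d) (e : R) :
  (forall i, h i x <= h i y + e) -> max_fun n0 h x <= max_fun n0 h y + e.
Proof.
move=> hxy; rewrite /max_fun; apply: bigmax_le => [|i _].
  by rewrite (le_trans (hxy _))// lerD2r; apply: le_bigmax.
by rewrite (le_trans (hxy _))// lerD2r; apply: le_bigmax.
Qed.

Lemma phiE (R : realType) (d n : nat) (alpha : R) (g : 'I_n -> 'rV[R]_d -> R)
    (x : 'rV[R]_d) :
  phi alpha g x = order_stat g (n - Num.truncn (alpha * n%:R)) x.
Proof.
by rewrite /phi /G1 big_ltn ?ltnS ?leq_subr// /G2 addrK.
Qed.

(** Being [M]-Lipschitz with one common [M] passes to the maxima and then to the
    order statistic, both being nonexpansive. *)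
Lemma phi_lipschitz_near (R : realType) (d n p : nat) (n0 : (0 < n)%N)
    (p0 : (0 < p)%N) (alpha : R) (h : 'I_n -> 'I_p -> 'rV[R]_d -> R)
    (x : 'rV[R]_d) :
  (forall s i, lipschitz_on (h s i) (nbhs (x, x))) ->
  lipschitz_on (phi alpha (fun s => max_fun p0 (h s))) (nbhs (x, x)).
Proof.
move=> hL; near (pinfty_nbhs R) => M; apply: (@klipschitzW _ _ _ M).
have hM s i : M.-lipschitz_on (h s i) (nbhs (x, x)).
  move: s i; near: M.
  by apply: filter_forall => s; apply: filter_forall => i; exact: hL.
have : \forall q \near nbhs (x, x), forall s i,
    `|h s i q.1 - h s i q.2| <= M * `|q.1 - q.2|.
  by apply: filter_forall => s; apply: filter_forall => i; exact: hM.
apply: filterS => -[y z] /= yzM.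
have main u v : (forall s i, h s i u <= h s i v + M * `|y - z|) ->
    phi alpha (fun s => max_fun p0 (h s)) u <=
      phi alpha (fun s => max_fun p0 (h s)) v + M * `|y - z|.
  move=> huv; rewrite !phiE; apply: ler_nth_sort => [s|].
    exact: max_fun_le.
  rewrite size_enum_ord.
  by case: (n - _)%N (leq_subr (Num.truncn (alpha * n%:R)) n).
rewrite ler_distlC lerBlDr; apply/andP; split; last first.
  apply: main => s i.
  by rewrite -lerBlDl (le_trans (ler_norm _))// distrC yzM.
by apply: main => s i; rewrite -lerBlDl (le_trans (ler_norm _))// yzM.
Unshelve. all: by end_near. Qed.

(** * Error bound and exact penalty *)

(** The upper limit is an infimum of suprema over neighborhoods, so a negative
    value is witnessed by one neighborhood with a negative supremum. *)
Lemma clarke_descent (R : realType) (d : nat) (p : 'rV[R]_d -> R)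
    (x v : 'rV[R]_d) :
  (clarke_derivative p x v < 0)%E ->
  exists c e : R, [/\ 0 < c, 0 < e & forall z t, `|x - z| < e -> 0 < t < e ->
    p (z + t *: v) <= p z - c * t].
Proof.
rewrite /clarke_derivative /limf_esup => /ereal_inf_lt[_ [V FV <-]] supV.
have [c c0 supc] : exists2 c : R, 0 < c & (ereal_sup [set
    ((p (z.1 + z.2 *: v) - p z.1) / z.2)%:E | z in V] <= (- c)%:E)%E.
  case: (ereal_sup _) supV => [r r0||_]; last by exists 1; rewrite ?leNye.
    by exists (- r); rewrite ?opprK// oppr_gt0.
  by rewrite ltNge leey.
case: FV => -[P Q] /= [/nbhs_ballP[e1 /= e10 eP] /nbhs_ballP[e2 /= e20 eQ]] PQ.
exists c, (Num.min e1 e2); split => //; first by rewrite lt_min e10.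
move=> z t; rewrite !lt_min => /andP[xz _] /andP[t0 /andP[_ te]].
have Vzt : V (z, t).
  apply: PQ; split => /=; first by apply: eP; rewrite -ball_normE.
  by apply: eQ => //; rewrite -ball_normE/= sub0r normrN gtr0_norm.
have : (((p (z + t *: v) - p z) / t)%:E <= (- c)%:E)%E.
  by apply: le_trans supc; apply: ereal_sup_ubound; exists (z, t).
by rewrite lee_fin ler_pdivrMr//; lra.
Qed.

Lemma convex_set_segment (R : realType) (V : lmodType R) (X : set V)
    (x y : V) (t : R) :
  @convex_set R V X -> X x -> X y -> 0 <= t <= 1 -> X (x + t *: (y - x)).
Proof.
move=> cX Xx Xy /andP[t0 t1].
have := cX y x (Itv01 t0 t1); rewrite !inE => /(_ Xy Xx); congr (X _).
by rewrite /conv/= scalerBl scale1r scalerBr addrCA.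
Qed.

(** A metric regularity property of the constraint [p <= 0] on [X].  The tangent
    vector [v] need not be a feasible direction at [x], let alone at nearby
    points [y]; it is replaced by [w], which points from [y] to a fixed element
    [u n] of [X]. *)
Lemma linear_error_bound (R : realType) (d : nat) (X : set 'rV[R]_d)
    (p : 'rV[R]_d -> R) (x v : 'rV[R]_d) :
  @convex_set R 'rV[R]_d X -> lipschitz_on p (nbhs (x, x)) -> p x = 0 ->
  tangent_cone X x v -> (clarke_derivative p x v < 0)%E ->
  exists2 C : R, 0 <= C & \forall y \near x, X y ->
    exists z, [/\ X z, p z <= 0 & `|y - z| <= C * pos_part (p y)].
Proof.
move=> cX /lipschitz_nearP[k [e1 [k0 e10 pk]]] px0 [u [t [Xu t0 _ _ uv]]].
move=> /clarke_descent[c [e2 [c0 e20 pc]]].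
(* eta is how far from v a direction may be: it costs at most half of the rate
   c, and the direction stays of norm at most L. *)
pose eta := Num.min 1 (c / (2 * k)); pose L := `|v| + 1.
have eta0 : 0 < eta by rewrite lt_min ltr01 divr_gt0// mulr_gt0.
have L0 : 0 < L by rewrite ltr_wpDl.
have [n vn] : exists n, `|v - (t n)^-1 *: (u n - x)| < eta / 2.
  have eta20 : 0 < eta / 2 by rewrite divr_gt0.
  by move/cvgrPdist_lt: uv => /(_ _ eta20) /filter_ex.
(* Below T, a step from y ends before u n and stays where pc and pk apply. *)
have tn0 := t0 n; pose T := Num.min (Num.min (t n) e2) (e1 / (2 * L)).
have T0 : 0 < T by rewrite !lt_min tn0 e20/= divr_gt0// mulr_gt0.
exists (2 * L / c); first by rewrite ltW// divr_gt0// mulr_gt0.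
have near_x r : 0 < r -> \forall y \near x, `|x - y| < r.
  by move=> r0; apply/nbhs_ballP; exists r => // y; rewrite -ball_normE.
near=> y => Xy; have [py0|py0] := leP (p y) 0.
  exists y; split => //; rewrite subrr normr0 /pos_part.
  by rewrite mulr_ge0 ?le_max ?lexx ?orbT// ltW// divr_gt0// mulr_gt0.
have -> : pos_part (p y) = p y by rewrite /pos_part max_l// ltW.
have xy1 : `|x - y| < e1 / 2 by near: y; apply: near_x; rewrite divr_gt0.
have xy2 : `|x - y| < e2 by near: y; exact: near_x.
have xyn : `|x - y| < t n * (eta / 2).
  by near: y; apply: near_x; rewrite mulr_gt0// divr_gt0.
have xyT : `|x - y| < c / 2 * T / k.
  by near: y; apply: near_x; rewrite divr_gt0// mulr_gt0// divr_gt0.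
(* the step at which the rate c / 2 brings p y down to 0 *)
pose tau := 2 * p y / c; pose w := (t n)^-1 *: (u n - y).
have tau0 : 0 < tau by rewrite divr_gt0// mulr_gt0.
have tauT : tau < T.
  have : p y <= k * `|x - y|.
    have xye1 : `|x - y| < e1 by lra.
    have := pk y x xye1; rewrite subrr normr0 px0 subr0 => /(_ e10).
    by rewrite [`|y - x|]distrC; exact: le_trans (ler_norm _).
  rewrite /tau ltr_pdivrMr// => pyk; move: xyT; rewrite ltr_pdivlMr// => xyT.
  by lra.
have /and3P[taun tau2 tauL] : [&& tau < t n, tau < e2 & tau < e1 / (2 * L)].
  by move: tauT; rewrite !lt_min andbA.
have vw : `|v - w| < eta.
  have -> : v - w = (v - (t n)^-1 *: (u n - x)) + (t n)^-1 *: (y - x).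
    by apply/rowP => i; rewrite !mxE; ring.
  rewrite (le_lt_trans (ler_normD _ _))// [ltRHS]splitr ltrD//.
  by rewrite normrZ distrC gtr0_norm ?invr_gt0// ltr_pdivrMl.
have wL : `|w| <= L.
  rewrite -[w](subKr v) (le_trans (ler_normB _ _))// lerD2l.
  by rewrite ltW// (lt_le_trans vw)// ge_min lexx.
have step_near (q : 'rV[R]_d) : `|q| <= L -> `|x - (y + tau *: q)| < e1.
  move=> qL; rewrite opprD addrA (le_lt_trans (ler_normB _ _))//.
  rewrite normrZ gtr0_norm// [ltRHS]splitr ltrD//.
  rewrite (@le_lt_trans _ _ (tau * L))//.
    by rewrite ler_pM2l.
  by move: tauL; rewrite invfM mulrA ltr_pdivlMr.
exists (y + tau *: w); split.
- have -> : tau *: w = (tau / t n) *: (u n - y) by rewrite scalerA.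
  apply: convex_set_segment => //.
  by rewrite ler_pdivrMr// mul1r (ltW taun) divr_ge0// ltW.
- have pw : p (y + tau *: w) <= p (y + tau *: v) + k * (tau * eta).
    rewrite -lerBlDl (le_trans (ler_norm _))// (le_trans (pk _ _ _ _))//.
    + exact: step_near.
    + by apply: step_near; rewrite lerDl.
    rewrite opprD addrACA subrr add0r -scalerBr normrZ gtr0_norm// distrC.
    by rewrite !ler_pM2l// ltW.
  have ketac : k * eta <= c / 2.
    apply: (@le_trans _ _ (k * (c / (2 * k)))).
      by rewrite ler_pM2l// ge_min lexx orbT.
    by rewrite le_eqVlt; apply/orP; left; apply/eqP; field; rewrite gt_eqF.
  have pv : p (y + tau *: v) <= p y - c * tau by apply: pc; rewrite ?tau0.
  have ctau : c * tau = 2 * p y by rewrite /tau; field; rewrite gt_eqF.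
  have : k * (tau * eta) <= c / 2 * tau by rewrite mulrCA mulrC ler_pM2r.
  lra.
- rewrite opprD addrA subrr add0r normrN normrZ gtr0_norm//.
  have -> : 2 * L / c * p y = tau * L by rewrite /tau; ring.
  by rewrite ler_pM2l.
Unshelve. all: by end_near. Qed.

(** Comparing [y] with the point [z] given by the error bound, which is feasible
    and close enough to [x] for [f x <= f z]: moving from [y] to [z] changes [f]
    by at most [k * C] times the violation, [k] being a Lipschitz constant of
    [f].  The Lipschitz condition on [p] makes the violation small near [x], so
    that [z] is near [x] as well. *)
Lemma exact_penalty (R : realType) (V : normedModType R) (X : set V)
    (f p : V -> R) (x : V) (C : R) :
  0 <= C -> lipschitz_on f (nbhs (x, x)) -> lipschitz_on p (nbhs (x, x)) ->
  p x <= 0 ->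
  (\forall y \near x, X y ->
    exists z, [/\ X z, p z <= 0 & `|y - z| <= C * pos_part (p y)]) ->
  (\forall y \near x, X y -> p y <= 0 -> f x <= f y) ->
  exists2 sigma0 : R, 0 < sigma0 & forall sigma, sigma0 < sigma ->
    \forall y \near x, X y ->
      f x + sigma * pos_part (p x) <= f y + sigma * pos_part (p y).
Proof.
move=> C0 /lipschitz_nearP[k [e [k0 e0 fk]]].
move=> /lipschitz_nearP[l [e' [l0 e'0 pl]]].
move=> px0 eb /nbhs_ballP[r /= r0 fmin].
(* k * C itself would do, but it may vanish *)
exists (k * C + 1) => [|sigma sigmaC].
  by rewrite ltr_wpDl// mulr_ge0// ltW.
pose m := Num.min e r; have m0 : 0 < m by rewrite lt_min e0.
have near_x q : 0 < q -> \forall y \near x, `|x - y| < q.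
  by move=> q0; apply/nbhs_ballP; exists q => // y; rewrite -ball_normE.
near=> y => Xy.
have ppy0 : 0 <= pos_part (p y) by rewrite le_max lexx orbT.
have [z [Xz pz0 yz]] : exists z,
    [/\ X z, p z <= 0 & `|y - z| <= C * pos_part (p y)].
  by move: Xy; near: y.
have xym : `|x - y| < m / 2 by near: y; apply: near_x; rewrite divr_gt0.
have xye' : `|x - y| < e' by near: y; exact: near_x.
have xyC : `|x - y| < m / 2 / (C * l + 1).
  near: y; apply: near_x.
  by rewrite !divr_gt0// ltr_wpDl// mulr_ge0// ltW.
have ppyl : pos_part (p y) <= l * `|x - y|.
  rewrite ge_max mulr_ge0 ?(ltW l0)// andbT.
  have := pl y x xye'; rewrite subrr normr0 => /(_ e'0).
  by move=> /(le_trans (ler_norm _)); rewrite [`|y - x|]distrC; lra.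
have yzm : `|y - z| < m / 2.
  apply: le_lt_trans yz _; apply: le_lt_trans (ler_wpM2l C0 ppyl) _.
  move: xyC; rewrite ltr_pdivlMr ?ltr_wpDl ?mulr_ge0 ?(ltW l0)//.
  by have := normr_ge0 (x - y); nra.
have xzm : `|x - z| < m.
  by rewrite -(subrKA y) (le_lt_trans (ler_normD _ _))// [ltRHS]splitr ltrD.
have fxz : f x <= f z.
  apply: fmin => //; rewrite -ball_normE /=.
  by rewrite (lt_le_trans xzm)// ge_min lexx orbT.
have fzy : f z <= f y + k * `|y - z|.
  have me : m <= e by rewrite ge_min lexx.
  have := fk z y (lt_le_trans xzm me); rewrite [`|z - y|]distrC.
  move=> /(_ _)/(le_trans (ler_norm _)); rewrite lerBlDl; apply; lra.
have -> : pos_part (p x) = 0 by rewrite /pos_part max_r.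
rewrite mulr0 addr0 (le_trans fxz)// (le_trans fzy)// lerD2l.
apply: (@le_trans _ _ (k * (C * pos_part (p y)))); first by rewrite ler_pM2l.
by rewrite mulrA ler_wpM2r//; lra.
Unshelve. all: by end_near. Qed.

Theorem theorem3p4 (R : realType) (d nS nI : nat)
    (nS_gt0 : (0 < nS)%N) (nI_gt0 : (0 < nI)%N)
    (alpha : R) (alpha_gt0 : 0 < alpha) (alpha_lt1 : alpha < 1)
    (X U : set 'rV[R]_d)
    (X_compact : compact X)
    (X_convex : @convex_set R 'rV[R]_d X)
    (X_relint : relative_interior X !=set0)
    (U_open : open U) (XU : X `<=` U)
    (f : 'rV[R]_d -> R)
    (f_C1 : continuously_differentiable U f)
    (f_convex : convex_on U f)
    (h : 'I_nS -> 'I_nI -> 'rV[R]_d -> R)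
    (h_C1 : forall s i, continuously_differentiable setT (h s i))
    (h_convex : forall s i, convex_on setT (h s i)) :
  let g := fun s : 'I_nS => max_fun nI_gt0 (h s) in
  let phi := phi alpha g in
  forall (cq : clarke_cq X phi) (xbar : 'rV[R]_d) (Xxbar : X xbar),
  local_minimizer [set x | X x /\ phi x <= 0] f xbar
  <->
  (phi xbar <= 0 /\
   exists2 sigma0 : R, 0 < sigma0 &
     forall sigma : R, sigma0 < sigma ->
       local_minimizer X (fun x => f x + sigma * pos_part (phi x)) xbar).
Proof.
move=> g phi cq xbar Xxbar.
have phi_lip : lipschitz_on phi (nbhs (xbar, xbar)).
  apply: phi_lipschitz_near => // s i.
  by apply: (C1_lipschitz_near openT (h_C1 s i)).
have f_lip : lipschitz_on f (nbhs (xbar, xbar)).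
  by apply: (C1_lipschitz_near U_open f_C1); exact: XU.
split=> [[[_ px0] [r r0 fmin]]|[px0 [sigma0 _ pen]]]; last first.
  have [_ [r r0 rmin]] := pen (sigma0 + 1) ltac:(by rewrite ltrDl).
  split=> //; exists r => // y [Xy py0] xyr; have := rmin y Xy xyr.
  by rewrite /pos_part !max_r// !mulr0 !addr0.
split=> //.
have [C C0 eb] : exists2 C : R, 0 <= C & \forall y \near xbar, X y ->
    exists z, [/\ X z, phi z <= 0 & `|y - z| <= C * pos_part (phi y)].
  move: px0; rewrite le_eqVlt => /orP[/eqP px0|px0].
    by have [v Tv cv] := cq _ Xxbar px0; exact: linear_error_bound Tv cv.
  have phi_cont := lipschitz_near_continuous phi_lip.
  exists 0 => //; near=> y => Xy; exists y; split => //.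
    by apply: ltW; near: y; apply: (cvgr_lt _ phi_cont).
  by rewrite subrr normr0 mul0r.
have fmin' : \forall y \near xbar, X y -> phi y <= 0 -> f xbar <= f y.
  by apply/nbhs_eballP; exists r => // y xyr Xy py0; exact: fmin.
have [sigma0 sigma00 pen] := exact_penalty C0 f_lip phi_lip px0 eb fmin'.
exists sigma0 => // sigma /pen /nbhs_eballP[e e0 eP].
by split => //; exists e => // y Xy xye; exact: eP.
Unshelve. all: by end_near. Qed.
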